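(* Let $K=\mathbb{Q}(\sqrt{d})$ be a real quadratic field, where $d>1$ is a square-free positive integer. Then $n_K=1$ if and only if $d$ is of one of the following types: (T1) $d=m^2+1$ with $m\in\mathbb{N}$ odd; (T2) $d=m^2-1$ with $m\in\mathbb{N}$ even; (T3) $d=m^2+4$ with $m\in\mathbb{N}$ odd; (T4) $d=m^2-4$ with $m\in\mathbb{N}$ odd and $m>3$.
   Context: For a totally real number field $K$ with ring of integers $\mathcal{O}_K$ and unit group $\mathcal{O}_K^\times$, let $K_{>>0}$ be the set of totally positive elements of $K$. For $a\in K_{>>0}$ the unary (quadratic) form $ax^2$ has trace minimum $\mu(a)=\min_{x\in\mathcal{O}_K\setminus\{0\}}\mathrm{Tr}_{K/\mathbb{Q}}(ax^2)$ and set of minimal vectors $\mathcal{M}(a)=\{x\in\mathcal{O}_K:\mathrm{Tr}_{K/\mathbb{Q}}(ax^2)=\mu(a)\}$. The form $ax^2$ is perfect if $a$ is uniquely determined by $\mu(a)$ and $\mathcal{M}(a)$, i.e. $a$ is the only $b\in K_{>>0}$ with $\mathrm{Tr}_{K/\mathbb{Q}}(bv^2)=\mu(a)$ for all $v\in\mathcal{M}(a)$. Two forms $ax^2,bx^2$ are equivalent if $b=au^2$ for some $u\in\mathcal{O}_K^\times$, and homothetic if $b=\lambda a$ for some rational $\lambda>0$. $n_K$ denotes the number of classes of perfect unary forms over $K$ up to equivalence and homothety. *)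

(* Defs.v *)
(* K = Q(sqrt d) modelled as pairs (a, b) : rat * rat,
   standing for a + b*sqrt d; embedded into algC to speak of algebraic
   integers (Aint) and of the two real embeddings. *)
From HB Require Import structures.
From mathcomp Require Import all_boot all_order all_algebra all_field.
Set Implicit Arguments. Unset Strict Implicit. Unset Printing Implicit Defensive.
Import Order.TTheory GRing.Theory Num.Theory.
Local Open Scope ring_scope.

Definition squarefree (d : nat) : Prop :=
  forall p : nat, prime p -> ~~ (p * p %| d)%N.

Definition Kel := (rat * rat)%type.

Section QuadField.
Variable d : nat.

Definition sqd : algC := sqrtC (d%:R).

Definition emb1 (x : Kel) : algC := ratr x.1 + ratr x.2 * sqd.
Definition emb2 (x : Kel) : algC := ratr x.1 - ratr x.2 * sqd.

Definition Kone : Kel := (1, 0).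
Definition Kmul (x y : Kel) : Kel :=
  (x.1 * y.1 + d%:R * x.2 * y.2, x.1 * y.2 + x.2 * y.1).
Definition Kscale (l : rat) (x : Kel) : Kel := (l * x.1, l * x.2).

Definition Ktr (x : Kel) : rat := 2 * x.1.

Definition OK (x : Kel) : Prop := emb1 x \in Aint.

Definition OKunit (u : Kel) : Prop := OK u /\ exists v, OK v /\ Kmul u v = Kone.

Definition totpos (a : Kel) : Prop := 0 < emb1 a /\ 0 < emb2 a.

Definition uform (a x : Kel) : rat := Ktr (Kmul a (Kmul x x)).

Definition is_trace_min (a : Kel) (m : rat) : Prop :=
  (exists x, OK x /\ x <> (0, 0) /\ uform a x = m) /\
  (forall x, OK x -> x <> (0, 0) -> m <= uform a x).

Definition perfect (a : Kel) : Prop :=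
  totpos a /\ exists m, is_trace_min a m /\
    forall b, totpos b ->
      (forall v, OK v -> uform a v = m -> uform b v = m) -> b = a.

Definition equiv_homot (a b : Kel) : Prop :=
  exists l : rat, 0 < l /\ exists u, OKunit u /\ b = Kscale l (Kmul a (Kmul u u)).

Definition nK_is_one : Prop :=
  (exists a, perfect a) /\ (forall a b, perfect a -> perfect b -> equiv_homot a b).

End QuadField.

(* Main.v *)
(* For a totally positive a, the numbers Tr(a x^2) are the values at the points
   (s1(x)^2, s2(x)^2) of a positive linear functional on R^2, so that perfect
   forms are the edges of the convex hull of these points, and n_K counts edges
   modulo squares of units.  Since |N(x)| >= 1 for x <> 0, the point 1 is a
   vertex; rotating a supporting line about it gives a perfect a = 1 - r sqrt d
   with 1 as a minimal vector.  If n_K = 1, then a is equivalent to its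
   conjugate, conj a = a u^2 for a unit u, hence 1 and u are independent minimal
   vectors of a binary form, and O_K = Z + Z u with |Tr(a u)| <= 1.
   Conversely such r and u force n_K = 1: after a change by a unit, any
   totally positive b is a nonnegative combination of a and conj a, and it is
   perfect only if it lies on the boundary of that cone.  Finally O_K = Z + Z u
   makes the discriminant of u that of K, and |Tr(a u)| <= 1 says |Tr u| >= 4
   when N(u) = 1, which yields the four families. *)
Require Import Defs.
From mathcomp Require Import all_boot all_order all_algebra all_field.
From mathcomp Require Import ring lra zify.
Set Implicit Arguments. Unset Strict Implicit. Unset Printing Implicit Defensive.
Import Order.TTheory GRing.Theory Num.Theory.
Local Open Scope ring_scope.

(** * Square-free [d], the two embeddings and the ring of integers *)

(** The squared denominator of [q] is coprime to its squared numerator, hence divides [d]; a prime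
    factor of the denominator would contradict square-freeness. *)
Lemma squarefree_int_root (d : nat) (q : rat) :
  squarefree d -> d%:R * q ^+ 2 \is a Num.int -> q \is a Num.int.
Proof.
move=> sf /intrP [k Ek].
have q0 : (denq q)%:~R != 0 :> rat by rewrite intr_eq0 denq_eq0.
have E : (d%:Z * numq q ^+ 2 = k * denq q ^+ 2).
  apply: (@intr_inj rat); rewrite !(rmorphXn, rmorphM) /= -Ek.
  rewrite -{2}[q]divq_num_den -pmulrn; field; exact: q0.
have dv : (`|denq q| * `|denq q| %| d)%N.
  have : (`|denq q| ^ 2 %| d * `|numq q| ^ 2)%N.
    by apply/dvdnP; exists `|k|%N; move/(congr1 absz): E; rewrite !abszM -!mulnn.
  rewrite Gauss_dvdl ?mulnn //.
  by rewrite coprimeXl // coprimeXr // coprime_sym; apply: coprime_num_den.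
have d1 : (`|denq q| = 1)%N.
  apply/eqP; apply: contraT => n1.
  have /pdivP [p pp pd] : (1 < `|denq q|)%N.
    by rewrite ltn_neqAle eq_sym n1 absz_gt0 denq_eq0.
  by have := sf p pp; rewrite (dvdn_trans _ dv) // dvdn_mul.
rewrite Qint_def; have := denq_gt0 q; lia.
Qed.

Lemma squarefree_sqrt_irrational (d : nat) (p q : rat) :
  (1 < d)%N -> squarefree d -> p ^+ 2 = d%:R * q ^+ 2 -> q = 0.
Proof.
move=> d1 sf E; apply/eqP; apply: contraT => q0.
(* For nonzero [q], [d * (q / p)^2 = 1]; thus [q / p] is an integer and [d] divides 1. *)
have /intrP [k Ek] : q / p \is a Num.int.
  apply: (squarefree_int_root sf).
  have p0 : p != 0.
    apply: contra q0 => /eqP p0; move: E; rewrite p0 expr0n /= => /esym/eqP.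
    by rewrite mulf_eq0 pnatr_eq0 sqrf_eq0; case: eqP => // Hd; lia.
  by rewrite expr_div_n mulrA -E divff ?expf_neq0.
have p0 : p != 0.
  apply: contra q0 => /eqP p0; move: E; rewrite p0 expr0n /= => /esym/eqP.
  by rewrite mulf_eq0 pnatr_eq0 sqrf_eq0; case: eqP => // Hd; lia.
have E2 : (1 = d%:R * (k%:~R : rat) ^+ 2).
  by rewrite -Ek expr_div_n mulrA -E divff ?expf_neq0.
have : (1 = d%:Z * k ^+ 2).
  by apply: (@intr_inj rat); rewrite !(rmorphXn, rmorphM) /= -pmulrn.
move=> /(congr1 absz); rewrite abszM /= => /esym/eqP; rewrite muln_eq1; lia.
Qed.

Lemma sqdK d : sqd d ^+ 2 = d%:R.
Proof. exact: sqrtCK. Qed.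

Lemma ratrE : ((forall n, (ratr n%:R = n%:R :> algC)%R) *
    (forall p q : rat, (ratr (p + q) = ratr p + ratr q :> algC)%R) *
    (forall p : rat, (ratr (- p) = - ratr p :> algC)%R) *
    (forall (p : rat) n, (ratr (p ^+ n) = ratr p ^+ n :> algC)%R) *
    (forall p q : rat, (ratr (p * q) = ratr p * ratr q :> algC)%R))%type.
Proof.
do !split=> *; rewrite ?(rmorphD, rmorphN, rmorphXn, ratr_nat) //.
exact: rmorphM.
Qed.

(** Conjugation commutes with rational polynomials; this carries a minimal polynomial over to the
    conjugate. *)
Lemma emb_horner d x (p : {poly rat}) :
  exists A B : rat, (map_poly ratr p).[emb1 d x] = ratr A + ratr B * sqd d /\
     (map_poly ratr p).[emb2 d x] = ratr A - ratr B * sqd d.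
Proof.
elim/poly_ind: p => [|p c [A [B [E1 E2]]]].
  by exists 0, 0; rewrite !rmorph0 !horner0; split; ring.
exists (A * x.1 + d%:R * B * x.2 + c), (A * x.2 + B * x.1).
rewrite rmorphD rmorphM /= map_polyX map_polyC /=.
rewrite !hornerE E1 E2 /emb1 /emb2 !ratrE -(sqdK d); split; ring.
Qed.

Lemma emb_eq0 d (A B : rat) : (1 < d)%N -> squarefree d ->
  ratr A + ratr B * sqd d = 0 -> A = 0 /\ B = 0.
Proof.
move=> d1 sf E.
have B0 : B = 0.
  apply: (@squarefree_sqrt_irrational d A) => //.
  apply: (fmorph_inj (ratr : rat -> algC)).
  rewrite /= !ratrE -sqdK.
  have -> : ratr A = - (ratr B * sqd d) :> algC by apply/eqP; rewrite -addr_eq0 E.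
  by ring.
split=> //; move: E; rewrite B0 rmorph0 mul0r addr0 => /eqP.
by rewrite fmorph_eq0 => /eqP.
Qed.

Definition Kconj (x : Kel) : Kel := (x.1, - x.2).
Definition Knorm (d : nat) (x : Kel) : rat := x.1 ^+ 2 - d%:R * x.2 ^+ 2.

Lemma emb1_conj d x : emb1 d (Kconj x) = emb2 d x.
Proof. by rewrite /emb1 /emb2 /= rmorphN mulNr. Qed.

(** The minimal polynomial of [x] over Q, monic and integral, also annihilates the conjugate. *)
Lemma OK_conj d x : (1 < d)%N -> squarefree d -> OK d x -> OK d (Kconj x).
Proof.
move=> d1 sf; rewrite /OK emb1_conj => Ax.
apply: (root_monic_Aint _ (minCpoly_monic (emb1 d x))) => //.
have [p [Ep _] _] := minCpolyP (emb1 d x).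
have := root_minCpoly (emb1 d x); rewrite Ep /root.
have [A [B [-> ->]]] := emb_horner d x p.
by move=> /eqP /(emb_eq0 d1 sf) [-> ->]; rewrite !rmorph0 mul0r subrr.
Qed.

Lemma emb1M d x y : emb1 d (Kmul d x y) = emb1 d x * emb1 d y.
Proof.
rewrite /emb1 /Kmul /= !ratrE -sqdK; ring.
Qed.

Lemma OK_mul d x y : OK d x -> OK d y -> OK d (Kmul d x y).
Proof. by rewrite /OK emb1M => Hx Hy; rewrite rpredM. Qed.

Lemma OK_add d x y : OK d x -> OK d y -> OK d (x.1 + y.1, x.2 + y.2).
Proof.
rewrite /OK /emb1 /= !ratrE => Hx Hy.
have -> : ratr x.1 + ratr y.1 + (ratr x.2 + ratr y.2) * sqd d =
  (ratr x.1 + ratr x.2 * sqd d) + (ratr y.1 + ratr y.2 * sqd d) by ring.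
exact: rpredD.
Qed.

Lemma ratr_Aint (q : rat) : (ratr q : algC) \in Aint -> q \is a Num.int.
Proof.
move=> /(Cint_rat_Aint (Crat_rat q)) /intrP [k Ek].
apply/intrP; exists k; apply: (fmorph_inj (ratr : rat -> algC)).
by rewrite /= Ek ratr_int.
Qed.

Lemma OK_int d (k : int) : OK d (k%:~R, 0).
Proof. by rewrite /OK /emb1 /= rmorph0 mul0r addr0 ratr_int Aint_int. Qed.

Lemma OK_norm d x : (1 < d)%N -> squarefree d -> OK d x -> Knorm d x \is a Num.int.
Proof.
move=> d1 sf Hx; apply: ratr_Aint.
suff <- : emb1 d (Kmul d x (Kconj x)) = ratr (Knorm d x).
  exact: OK_mul Hx (OK_conj d1 sf Hx).
rewrite /emb1 /Kmul /Knorm /=.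
rewrite (_ : x.1 * - x.2 + x.2 * x.1 = 0); last by ring.
by rewrite rmorph0 mul0r addr0; congr ratr; ring.
Qed.

Lemma OK_trace d x : (1 < d)%N -> squarefree d -> OK d x -> 2 * x.1 \is a Num.int.
Proof.
move=> d1 sf Hx; apply: ratr_Aint.
suff <- : emb1 d (x.1 + (Kconj x).1, x.2 + (Kconj x).2) = ratr (2 * x.1).
  exact: OK_add Hx (OK_conj d1 sf Hx).
by rewrite /emb1 /= subrr rmorph0 mul0r addr0; congr ratr; ring.
Qed.

(** X^2 - Tr(x) X + N(x) is monic and integral and has [x] as a root. *)
Lemma trace_norm_OK d x : 2 * x.1 \is a Num.int -> Knorm d x \is a Num.int -> OK d x.
Proof.
move=> /intrP [P EP] /intrP [N EN].
set q : {poly algC} := - P%:~R *: 'X + (N%:~R)%:P.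
have sq : (size q < 3)%N.
  rewrite /q (leq_ltn_trans (size_polyD _ _)) // gtn_max.
  rewrite (leq_ltn_trans (size_scale_leq _ _)) ?size_polyX //.
  by rewrite (leq_ltn_trans (size_polyC_leq1 _)).
apply: (@root_monic_Aint ('X^2 + q)).
- apply/eqP; rewrite /q !hornerD hornerXn hornerZ hornerX hornerC /emb1.
  have -> : (P%:~R : algC) = 2 * ratr x.1.
    by rewrite -[P%:~R](ratr_int _ P) -EP !ratrE.
  have -> : (N%:~R : algC) = ratr x.1 ^+ 2 - sqd d ^+ 2 * ratr x.2 ^+ 2.
    by rewrite -[N%:~R](ratr_int _ N) -EN /Knorm !ratrE sqdK.
  by ring.
- by rewrite monicE lead_coefDl ?lead_coefXn // size_polyXn.
- apply/polyOverP=> i; rewrite /q !coefD coefXn coefZ coefX coefC.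
  apply/intrP; exists ((i == 2%N)%:R + (- P * (i == 1%N)%:R + if i == 0%N then N else 0)).
  by rewrite !(rmorphD, rmorphN, rmorphM, rmorph_nat) /=; case: (i == 0%N).
Qed.

(** [d * (2 * x.2)^2] equals Tr(x)^2 - 4 N(x), an integer, so square-freeness makes [2 * x.2] an
    integer. Halves serve all residues of [d] modulo 4 at once. *)
Lemma OK_halves d x : (1 < d)%N -> squarefree d -> OK d x ->
  exists P Q N : int, [/\ x.1 = P%:~R / 2, x.2 = Q%:~R / 2,
    P ^+ 2 - d%:Z * Q ^+ 2 = 4 * N & Knorm d x = N%:~R].
Proof.
move=> d1 sf Hx.
have /intrP [P EP] := OK_trace d1 sf Hx.
have /intrP [N EN] := OK_norm d1 sf Hx.
have /intrP [Q EQ] : 2 * x.2 \is a Num.int.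
  apply: (squarefree_int_root sf); apply/intrP; exists (P ^+ 2 - 4 * N).
  rewrite !(rmorphXn, rmorphB, rmorphM) /= -EP -EN /Knorm; ring.
exists P, Q, N; split=> //; [by rewrite -EP; field | by rewrite -EQ; field |].
apply: (@intr_inj rat).
rewrite !(rmorphXn, rmorphB, rmorphM) /= -EP -EQ -EN /Knorm -pmulrn; ring.
Qed.

(** Trace and norm are the sum and product of the two real embeddings, so positivity becomes a pair
    of rational inequalities. *)
Lemma totposE d x : (1 < d)%N -> squarefree d ->
  totpos d x <-> 0 < x.1 /\ 0 < Knorm d x.
Proof.
move=> d1 sf; set s := sqd d.
have s0 : 0 < s by rewrite sqrtC_gt0 ltr0n; lia.
have Hn : emb1 d x * emb2 d x = ratr (Knorm d x).
  by rewrite /emb1 /emb2 /Knorm !ratrE -sqdK; ring.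
have Ht : emb1 d x + emb2 d x = ratr (2 * x.1).
  by rewrite /emb1 /emb2 !ratrE; ring.
have Rq (q : rat) : (ratr q : algC) \is Num.real by apply/Creal_Crat/Crat_rat.
have R1 : emb1 d x \is Num.real.
  by apply: realD => //; apply: realM => //; apply: gtr0_real.
have R2 : emb2 d x \is Num.real.
  by apply: realB => //; apply: realM => //; apply: gtr0_real.
split=> -[h1 h2].
  have := addr_gt0 h1 h2; rewrite Ht ltr0q => h.
  have := mulr_gt0 h1 h2; rewrite Hn ltr0q; split=> //; lra.
have hn : 0 < emb1 d x * emb2 d x by rewrite Hn ltr0q.
have ht : 0 < emb1 d x + emb2 d x by rewrite Ht ltr0q; lra.
have := R1; rewrite realE => /orP [] g1.
  have p1 : 0 < emb1 d x.
    by rewrite lt_neqAle g1 andbT; apply: contraTneq hn => <-; rewrite mul0r ltxx.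
  by split=> //; move: hn; rewrite pmulr_rgt0.
have g2 : emb2 d x <= 0.
  rewrite real_leNgt ?real0 //; apply/negP => g2.
  by have := lt_le_trans hn (mulr_le0_ge0 g1 (ltW g2)); rewrite ltxx.
by have := lt_le_trans ht (lerD g1 g2); rewrite addr0 ltxx.
Qed.


(** * Trace forms, conjugation and units *)

Lemma uformE d a x :
  uform d a x = 2 * (a.1 * (x.1 ^+ 2 + d%:R * x.2 ^+ 2) + 2 * d%:R * a.2 * x.1 * x.2).
Proof. by rewrite /uform /Ktr /Kmul /=; ring. Qed.

Lemma KmulA d : associative (Kmul d).
Proof. by move=> x y z; rewrite /Kmul /=; congr (_, _); ring. Qed.

Lemma KmulC d : commutative (Kmul d).
Proof. by move=> x y; rewrite /Kmul /=; congr (_, _); ring. Qed.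

Lemma Kmul1 d x : Kmul d x Kone = x.
Proof. by case: x => x y; rewrite /Kmul /=; congr (_, _); ring. Qed.

Lemma Kmul_conj d x y : Kmul d (Kconj x) (Kconj y) = Kconj (Kmul d x y).
Proof. by rewrite /Kmul /Kconj /=; congr (_, _); ring. Qed.

Lemma KconjK : involutive Kconj.
Proof. by case=> x y; rewrite /Kconj /= opprK. Qed.

Lemma Knorm_conj d x : Knorm d (Kconj x) = Knorm d x.
Proof. by rewrite /Knorm /= sqrrN. Qed.

Lemma KnormM d x y : Knorm d (Kmul d x y) = Knorm d x * Knorm d y.
Proof. by rewrite /Knorm /Kmul /=; ring. Qed.

Lemma uform_mul d a u x : uform d (Kmul d a (Kmul d u u)) x = uform d a (Kmul d u x).
Proof. by rewrite /uform /Ktr /Kmul /=; ring. Qed.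

Lemma uform_conj d a x : uform d (Kconj a) (Kconj x) = uform d a x.
Proof. by rewrite !uformE /=; ring. Qed.

Lemma uform_scale d l a x : uform d (Kscale l a) x = l * uform d a x.
Proof. by rewrite !uformE /=; ring. Qed.

Lemma OK1 d : OK d Kone.
Proof. exact: (OK_int d 1). Qed.

Lemma OK_opp d x : OK d x -> OK d (- x.1, - x.2).
Proof.
move=> /(OK_mul (OK_int d (-1))); congr OK.
by rewrite /Kmul /=; congr (_, _); rewrite rmorphN1; ring.
Qed.

Lemma OKunit_conj d u : (1 < d)%N -> squarefree d -> OKunit d u -> OKunit d (Kconj u).
Proof.
move=> d1 sf [Hu [v [Hv E]]]; split; first exact: OK_conj.
exists (Kconj v); split; first exact: OK_conj.
by rewrite Kmul_conj E /Kconj /= oppr0.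
Qed.

Lemma OKunit_mul d u v : OKunit d u -> OKunit d v -> OKunit d (Kmul d u v).
Proof.
move=> [Hu [u' [Hu' Eu]]] [Hv [v' [Hv' Ev]]]; split; first exact: OK_mul.
exists (Kmul d v' u'); split; first exact: OK_mul.
by rewrite KmulA -(KmulA _ u) Ev Kmul1.
Qed.

Lemma OKunit1 d : OKunit d Kone.
Proof. by split; [exact: OK1|exists Kone; split; [exact: OK1|exact: Kmul1]]. Qed.

Lemma OKunitP d u : (1 < d)%N -> squarefree d ->
  OKunit d u <-> OK d u /\ (Knorm d u = 1 \/ Knorm d u = -1).
Proof.
move=> d1 sf; split=> [[Hu [v [Hv E]]]|[Hu N1]]; last first.
  split=> //; exists (Kscale (Knorm d u) (Kconj u)); split.
    have [->|->] := N1; rewrite /Kscale ?mul1r ?mulN1r; first exact: (OK_conj d1 sf Hu).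
    exact: OK_opp (OK_conj d1 sf Hu).
  have : Knorm d u ^+ 2 = 1 by case: N1 => ->; ring.
  rewrite /Kmul /Kscale /Kconj /Kone /Knorm /= => N2.
  by congr (_, _); [rewrite -[RHS]N2; ring | ring].
split=> //.
have /intrP [m Em] := OK_norm d1 sf Hu; have /intrP [n En] := OK_norm d1 sf Hv.
have : m * n = 1.
  apply: (@intr_inj rat); rewrite rmorphM /= -Em -En -KnormM E.
  by rewrite /Knorm /=; ring.
move/(congr1 absz); rewrite abszM => /eqP; rewrite muln_eq1 => /andP [/eqP m1 _].
rewrite Em; have [->|->] : m = 1 \/ m = -1 by lia.
  by left.
by right.
Qed.

Lemma OKunit_neq0 d u : (1 < d)%N -> squarefree d -> OKunit d u -> u <> (0, 0).
Proof.
move=> d1 sf /(OKunitP _ d1 sf) [_ N] E0; move: N; rewrite E0 /Knorm /= expr0n mulr0 subr0.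
by case=> /eqP; rewrite eq_sym ?oner_eq0 ?oppr_eq0 ?oner_eq0.
Qed.

Lemma Knorm_ge1 d x : (1 < d)%N -> squarefree d -> OK d x -> x <> (0, 0) ->
  1 <= `|Knorm d x|.
Proof.
move=> d1 sf Hx x0.
have /intrP [n En] := OK_norm d1 sf Hx.
suff n0 : n != 0 by rewrite En -intr_norm ler1z; lia.
apply/eqP => n0; apply: x0.
have E : x.1 ^+ 2 = d%:R * x.2 ^+ 2 by apply/eqP; rewrite -subr_eq0 [_ - _]En n0.
have y0 := squarefree_sqrt_irrational d1 sf E.
move: E; rewrite y0 expr0n mulr0 => /eqP; rewrite sqrf_eq0 => /eqP.
by move: y0; case: (x) => /= ? ? -> ->.
Qed.

Lemma perfect_conj d a : (1 < d)%N -> squarefree d ->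
  perfect d a -> perfect d (Kconj a).
Proof.
move=> d1 sf.
have Htp b : totpos d b -> totpos d (Kconj b).
  by rewrite !totposE // Knorm_conj.
move=> [ta [m [[[x [Hx [x0 Ex]]] Hm] U]]]; split; first exact: Htp.
exists m; split.
  split=> [|y Hy y0].
    exists (Kconj x); split; [exact: OK_conj | split; last by rewrite uform_conj].
    by move=> E; apply: x0; rewrite -[x]KconjK E /Kconj /= oppr0.
  rewrite -[y]KconjK uform_conj; apply: Hm; first exact: OK_conj.
  by move=> E; apply: y0; rewrite -[y]KconjK E /Kconj /= oppr0.
move=> b tb Hb; rewrite -[b]KconjK; congr Kconj; apply: U; first exact: Htp.
move=> v Hv Ev; rewrite -[v]KconjK uform_conj; apply: Hb; first exact: OK_conj.
by rewrite uform_conj.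
Qed.

(** * Finite sublevel sets and attained minima *)

(** The sublevel set of [x0] lies in a finite list, so a minimum over [x0 :: s] is global. It serves
    both for slopes of edges and for values at units. *)
Lemma exists_minimizer (T : eqType) (s : seq T) (P : pred T) (f : T -> rat) (x0 : T) :
  P x0 -> (forall x, P x -> f x <= f x0 -> x \in s) ->
  exists2 x, P x & forall y, P y -> f x <= f y.
Proof.
move=> P0 Hs.
have [x Px Hx] : exists2 x, P x & forall y, y \in x0 :: s -> P y -> f x <= f y.
  elim: s {Hs} => [|z s [x Px Hx]].
    by exists x0 => // y; rewrite inE => /eqP ->.
  have [/andP[Pz zx]|nz] := boolP (P z && (f z < f x)).
    exists z => // y; rewrite !inE orbCA => /orP [/eqP -> //|ys] Py.
    by apply: le_trans (ltW zx) (Hx _ _ Py); rewrite inE.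
  exists x => // y; rewrite !inE orbCA => /orP [/eqP -> |ys] Py.
    by move: nz; rewrite Py /= -leNgt.
  by rewrite Hx // inE.
exists x => // y Py.
have [yx|/ltW xy] := leP (f y) (f x0); first by rewrite Hx // inE Hs ?orbT.
by apply: le_trans xy; apply: Hx; rewrite ?inE ?eqxx.
Qed.

(** Completing the square in either coordinate bounds both [x.1] and [x.2], because N(a) > 0; a box
    contains finitely many half-integer points. *)
Lemma OK_sublevel_finite d a (C : rat) : (1 < d)%N -> squarefree d -> totpos d a ->
  exists s : seq Kel, forall x, OK d x -> uform d a x <= C -> x \in s.
Proof.
move=> d1 sf /(totposE _ d1 sf) [a1 aN].
set k := Knorm d a in aN.
have [B HB] : exists B : nat, forall t : rat, k * t ^+ 2 <= 2 * a.1 * C -> `|t| <= B%:R.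
  (* The added 1 gives [t^2 + 1 <= D], hence [|t| <= D] with no square root. *)
  set D := (2 * a.1 * C) / k + 1.
  exists (Num.bound D) => t Ht.
  have D1 : t ^+ 2 + 1 <= D.
    by rewrite /D lerD2r ler_pdivlMr // mulrC.
  have tD : `|t| <= D.
    have := real_normK (num_real t); have := normr_ge0 t.
    by move: (`|t|) => s ? Es; nra.
  apply: (le_trans tD); apply: ltW; apply: archi_boundP.
  exact: le_trans (normr_ge0 t) tD.
(* The numerators over 2 of coordinates bounded by [B] run from -2B to 2B. *)
pose I := [seq i%:Z - (2 * B)%:Z | i <- iota 0 (4 * B).+1].
pose s := [seq ((i%:~R / 2, j%:~R / 2) : Kel) | i <- I, j <- I].
exists s => x Hx Ux.
have [P [Q [N [EP EQ _ _]]]] := OK_halves d1 sf Hx.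
have d0 : 1 <= d%:R :> rat by rewrite ler1n; lia.
have Dx : k * x.1 ^+ 2 + d%:R * (a.1 * x.2 + a.2 * x.1) ^+ 2 <= a.1 * C / 2.
  move: Ux; rewrite uformE => Ux; rewrite /k /Knorm.
  have -> : (a.1 ^+ 2 - d%:R * a.2 ^+ 2) * x.1 ^+ 2 +
     d%:R * (a.1 * x.2 + a.2 * x.1) ^+ 2 = a.1 * (2 * (a.1 * (x.1 ^+ 2 + d%:R * x.2 ^+ 2) +
        2 * d%:R * a.2 * x.1 * x.2)) / 2 by field.
  by rewrite ler_pM2r // ler_pM2l.
have Dy : k * x.2 ^+ 2 * d%:R + (a.1 * x.1 + d%:R * a.2 * x.2) ^+ 2 <= a.1 * C / 2.
  move: Ux; rewrite uformE => Ux; rewrite /k /Knorm.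
  have -> : (a.1 ^+ 2 - d%:R * a.2 ^+ 2) * x.2 ^+ 2 * d%:R +
     (a.1 * x.1 + d%:R * a.2 * x.2) ^+ 2 = a.1 * (2 * (a.1 * (x.1 ^+ 2 + d%:R * x.2 ^+ 2) +
        2 * d%:R * a.2 * x.1 * x.2)) / 2 by field.
  by rewrite ler_pM2r // ler_pM2l.
have kx : 0 <= k * x.1 ^+ 2 by rewrite mulr_ge0 ?sqr_ge0 // ltW.
have ky : 0 <= k * x.2 ^+ 2 by rewrite mulr_ge0 ?sqr_ge0 // ltW.
have sx := sqr_ge0 (a.1 * x.2 + a.2 * x.1).
have sy := sqr_ge0 (a.1 * x.1 + d%:R * a.2 * x.2).
have bx : `|x.1| <= B%:R by apply: HB; nra.
have bx2 : `|x.2| <= B%:R by apply: HB; nra.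
have mem (p : int) (t : rat) : t = p%:~R / 2 -> `|t| <= B%:R -> p \in I.
  move=> -> Ht.
  have {}Ht : `|p| <= (2 * B)%:Z.
    rewrite -(@ler_int rat) intr_norm -pmulrn natrM.
    by move: Ht; rewrite normrM normfV [`|2|]ger0_norm //; lra.
  move: Ht; rewrite /I; clear=> Ht; apply/mapP; exists (absz (p + (2 * B)%:Z)%R); last by lia.
  by rewrite mem_iota; lia.
have -> : x = (P%:~R / 2, Q%:~R / 2) by rewrite -EP -EQ; case: (x).
by apply: (allpairs_f (fun i j => (i%:~R / 2, j%:~R / 2))); [exact: mem EP _ | exact: mem EQ _].
Qed.


(* The segment from 1 to u^2 is an edge of the hull: Tr((1 - r sqrt d) x^2)
   takes its minimum 2 at 1 and at u, which generate O_K.  The trace bound says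
   that the form is reduced in this basis. *)
Record unit_edge (d : nat) (r : rat) (u : Kel) : Prop := UnitEdge {
  edge_slope_gt0 : 0 < r;
  edge_slope_lt : d%:R * r ^+ 2 < 1;
  edge_unit : OKunit d u;
  edge_mul : Kmul d (1, - r) (Kmul d u u) = (1, r);
  edge_trace : `|Ktr (Kmul d (1, - r) u)| <= 1;
  edge_basis : forall x, OK d x ->
    exists i j : int, x = (i%:~R + j%:~R * u.1, j%:~R * u.2)
}.

(* The r for which Tr((1 - r sqrt d) x^2) = 2 = Tr(1 - r sqrt d), when
   x.1 * x.2 <> 0. *)
Definition edge_slope (d : nat) (x : Kel) : rat :=
  (x.1 ^+ 2 + d%:R * x.2 ^+ 2 - 1) / (2 * d%:R * x.1 * x.2).

(** * The edge at the vertex 1 and the unit it yields *)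

Lemma edge_slope_le d x r : (1 < d)%N -> 0 < x.1 -> 0 < x.2 ->
  (edge_slope d x <= r) = (uform d (1, - r) x <= 2).
Proof.
move=> d1 x1 x2; have d0 : 0 < d%:R :> rat by rewrite ltr0n; lia.
have h : 0 < 2 * d%:R * x.1 * x.2 by rewrite !mulr_gt0.
rewrite /edge_slope ler_pdivrMr // uformE /=; apply/idP/idP; lra.
Qed.

(** For n = floor(sqrt d) the bound says (sqrt d - n)^2 < 1. It supplies a totally positive form
    from which the minimisation of slopes can start. *)
Lemma small_edge_slope d : (1 < d)%N -> squarefree d ->
  exists2 n : nat, (0 < n)%N & d%:R * edge_slope d (n%:R, 1) ^+ 2 < 1.
Proof.
move=> d1 sf.
have [n nd dn] : exists2 n, (n ^ 2 < d)%N & (d < n.+1 ^ 2)%N.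
  have ex : exists n, (n ^ 2 <= d)%N by exists 0%N.
  have ub n : (n ^ 2 <= d)%N -> (n <= d)%N by nia.
  case: (ex_maxnP ex ub) => n Hn Hmax; exists n.
    rewrite ltn_neqAle Hn andbT; apply/eqP => E.
    have := @squarefree_sqrt_irrational d n%:R 1 d1 sf.
    by rewrite -E natrX expr1n mulr1 => /(_ erefl) /eqP; rewrite oner_eq0.
  by rewrite ltnNge; apply/negP => /Hmax; rewrite ltnn.
have n0 : (0 < n)%N by nia.
exists n => //; rewrite /edge_slope /=.
have N0 : 0 < n%:R :> rat by rewrite ltr0n.
have d0 : 0 < d%:R :> rat by rewrite ltr0n; lia.
set t := (X in X / _).
have -> : d%:R * (t / (2 * d%:R * n%:R * 1)) ^+ 2 = t ^+ 2 / (4 * d%:R * n%:R ^+ 2).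
  by field; rewrite !lt0r_neq0.
rewrite ltr_pdivrMr ?mul1r ?mulr_gt0 ?exprn_gt0 //.
have e1 : n%:R ^+ 2 + 1 <= d%:R :> rat by rewrite -natrX natr1 ler_nat; lia.
have e2 : d%:R + 1 <= (n%:R + 1) ^+ 2 :> rat.
  by rewrite !natr1 -natrX ler_nat; lia.
rewrite /t; move: e1 e2 N0; move: (n%:R : rat) (d%:R : rat) => x y; clear=> *.
have -> : x ^+ 2 + y * 1 ^+ 2 - 1 = 2 * x ^+ 2 + (y - x ^+ 2 - 1) by ring.
rewrite -subr_gt0.
have -> : 4 * y * x ^+ 2 - (2 * x ^+ 2 + (y - x ^+ 2 - 1)) ^+ 2 =
    (2 * x) ^+ 2 - (y - x ^+ 2 - 1) ^+ 2 by ring.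
rewrite subr_sqr mulr_gt0 //; nra.
Qed.

(** Among elements of O_K with positive coordinates one of least slope exists. Its form takes the
    value 2 at 1 and at that element, and these two values determine both coordinates of a form. *)
Lemma perfect_edge_at_one d : (1 < d)%N -> squarefree d ->
  exists r, [/\ 0 < r, d%:R * r ^+ 2 < 1,
    forall x, OK d x -> x <> (0, 0) -> 2 <= uform d (1, - r) x & perfect d (1, - r)].
Proof.
move=> d1 sf; have d0 : 0 < d%:R :> rat by rewrite ltr0n; lia.
have [n n0 Hn] := small_edge_slope d1 sf.
set x0 : Kel := (n%:R, 1).
(* [OK d x] appears unfolded because the minimisation needs a boolean predicate. *)
pose P x := [&& emb1 d x \in Aint, 0 < x.1 & 0 < x.2].
have tp0 : totpos d (1, - edge_slope d x0).
  by rewrite totposE // /Knorm /= sqrrN expr1n subr_gt0.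
have [s Hs] := OK_sublevel_finite 2 d1 sf tp0.
have P0 : P x0.
  apply/and3P; split; rewrite /= ?ltr0n ?ltr01 //.
  have := OK_add (OK_int d n) (trace_norm_OK (d := d) (x := (0, 1)) _ _).
  rewrite /= addr0 add0r; apply.
    by rewrite mulr0; apply/intrP; exists 0.
  by apply/intrP; exists (- d%:Z); rewrite /Knorm /= rmorphN /= -pmulrn; ring.
have [x /and3P [Hx p1 p2] Hmin] :
    exists2 x, P x & forall y, P y -> edge_slope d x <= edge_slope d y.
  apply: (exists_minimizer (s := s) P0) => x /and3P [Hx p1 p2].
  by rewrite edge_slope_le // => /(Hs _ Hx).
have ux : uform d (1, - edge_slope d x) x = 2.
  by rewrite uformE /= /edge_slope; field; rewrite !lt0r_neq0.
have r0 : 0 < edge_slope d x.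
  rewrite divr_gt0 ?mulr_gt0 // subr_gt0.
  have : 1 <= `|Knorm d x|.
    by apply: Knorm_ge1 => // E; rewrite E ltxx in p1.
  have s1 : 0 < x.1 ^+ 2 by rewrite exprn_gt0.
  have s2 : 0 < d%:R * x.2 ^+ 2 by rewrite mulr_gt0 ?exprn_gt0.
  by rewrite /Knorm ler_normr => /orP []; lra.
exists (edge_slope d x).
have rd : d%:R * edge_slope d x ^+ 2 < 1.
  apply: le_lt_trans Hn; rewrite ler_pM2l // ler_pXn2r ?nnegrE ?(ltW r0) //.
    exact: Hmin.
  by rewrite (le_trans (ltW r0)) // Hmin.
have HM y : OK d y -> y <> (0, 0) -> 2 <= uform d (1, - edge_slope d x) y.
  move=> Hy y0.
  have pos z : OK d z -> 0 < z.1 -> 0 < z.2 -> 2 <= uform d (1, - edge_slope d x) z.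
    move=> Hz z1 z2; rewrite leNgt; apply/negP => lt.
    have Pz : P z by apply/and3P.
    have := Hmin z Pz; rewrite leNgt => /negP; apply.
    rewrite {1}/edge_slope ltr_pdivrMr ?mulr_gt0 //.
    by move: lt; rewrite uformE /=; lra.
  (* If [y.1 * y.2 > 0], minimality of the slope applies to [y] or to its opposite; otherwise the
     cross term is nonnegative and [y.1^2 + d * y.2^2 >= |N(y)| >= 1]. *)
  have [p|p] := ltP 0 (y.1 * y.2).
    have [y1|y1] := ltP 0 y.1; first by apply: pos => //; rewrite -(pmulr_rgt0 _ y1).
    have y1' : y.1 < 0.
      by rewrite lt_neqAle y1 andbT; apply: contraTneq p => ->; rewrite mul0r ltxx.
    have y2' : y.2 < 0 by rewrite -(nmulr_rgt0 _ y1').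
    have := pos _ (OK_opp Hy); rewrite /= !oppr_gt0 => /(_ y1' y2').
    by rewrite !uformE /=; lra.
  have := Knorm_ge1 d1 sf Hy y0.
  have : 0 <= d%:R * edge_slope d x * - (y.1 * y.2).
    by rewrite mulr_ge0 ?oppr_ge0 // mulr_ge0 // ltW.
  have s1 : 0 <= y.1 ^+ 2 by rewrite sqr_ge0.
  have s2 : 0 <= d%:R * y.2 ^+ 2 by rewrite mulr_ge0 ?sqr_ge0 ?ltW.
  by rewrite uformE /Knorm ler_normr => ? /orP [] /=; lra.
have tp : totpos d (1, - edge_slope d x).
  by rewrite totposE // /Knorm /= sqrrN expr1n subr_gt0.
split=> //; split=> //; exists 2; split.
  split=> //; exists Kone; split; [exact: OK1 | split=> //].
  by rewrite uformE /=; ring.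
move=> b _ Hb.
have e1 := Hb x Hx ux.
have b1 : b.1 = 1.
  have : uform d b Kone = 2 by apply: Hb; [exact: OK1 | rewrite uformE /=; ring].
  by rewrite uformE /=; lra.
have : (b.2 + edge_slope d x) * (4 * d%:R * x.1 * x.2) = 0.
  by move: ux e1; rewrite !uformE b1 /=; lra.
move/eqP; rewrite mulf_eq0 => /orP [|].
  by rewrite addr_eq0 => /eqP <-; rewrite -b1; case: (b).
by rewrite gt_eqF // !mulr_gt0.
Qed.

Lemma nK_is_one_edge d : (1 < d)%N -> squarefree d -> nK_is_one d ->
  exists r u, unit_edge d r u.
Proof.
move=> d1 sf [_ Heq]; have d0 : 0 < d%:R :> rat by rewrite ltr0n; lia.
have [r [r0 rd HM Hp]] := perfect_edge_at_one d1 sf.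
have [l [l0 [u [Hu E]]]] := Heq _ _ Hp (perfect_conj d1 sf Hp).
have nz w : OKunit d w -> w <> (0, 0) := OKunit_neq0 d1 sf.
(* With a = (1, -r) and [v] the inverse of [u], evaluate conj a = l a u^2 at 1 and at [v]: the first
   gives 2 = l Tr(a u^2) >= 2 l, the second 2 l >= 2. *)
have l1 : l = 1.
  have [Hou [v [Hv Ev]]] := Hu.
  have Hu' : OKunit d v by split=> //; exists u; split=> //; rewrite KmulC.
  have e1 : l * uform d (1, - r) u = 2.
    transitivity (uform d (Kconj (1, -r)) Kone); last by rewrite uformE /=; ring.
    by rewrite E uform_scale uform_mul Kmul1.
  have h1 := HM u Hou (nz _ Hu).
  have e2 : uform d (Kconj (1, - r)) v = 2 * l.
    rewrite E uform_scale uform_mul Ev uformE /=; ring.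
  have h2 : 2 <= uform d (Kconj (1, - r)) v.
    rewrite -[v]KconjK uform_conj; apply: HM; first exact: OK_conj.
    exact: nz (OKunit_conj d1 sf Hu').
  by nra.
have {}E : Kmul d (1, - r) (Kmul d u u) = (1, r).
  by move: E; rewrite l1 /Kscale !mul1r -surjective_pairing /Kconj /= opprK => <-.
exists r, u.
have Hou : OK d u by case: Hu.
have uu : uform d (1, - r) u = 2.
  by rewrite /uform E /Ktr /= mulr1.
(* A rational [u] would have u^2 = 1, making a equal to its conjugate. *)
have u2 : u.2 != 0.
  apply/eqP => u20; move: E; rewrite /Kmul u20 /= => -[e1 e2].
  have : u.1 ^+ 2 = 1 by lra.
  move=> e; have : - r * u.1 ^+ 2 = r by lra.
  by rewrite e; lra.
(* At u + 1 and u - 1 the form takes the values 4 + 2 Tr(a u) and 4 - 2 Tr(a u), both at least 2. *)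
have tr : `|Ktr (Kmul d (1, - r) u)| <= 1.
  have OKp := OK_add Hou (OK1 d); have OKm := OK_add Hou (OK_int d (-1)).
  have hp := HM _ OKp; have hm := HM _ OKm.
  have {}hp : 2 <= uform d (1, - r) (u.1 + 1, u.2 + 0).
    by apply: hp => e; move: (congr1 snd e) => /= /eqP; rewrite addr0; apply/negP.
  have {}hm : 2 <= uform d (1, - r) (u.1 + (-1)%:~R, u.2 + 0).
    by apply: hm => e; move: (congr1 snd e) => /= /eqP; rewrite addr0; apply/negP.
  move: hp hm uu; rewrite !uformE /Ktr /Kmul /= !addr0 => hp hm uu.
  by rewrite ler_norml; apply/andP; split; nra.
split=> // x Hx.
have [t Et] : exists t, t = x.2 / u.2 by eexists.
have [s Es] : exists s, s = x.1 - t * u.1 by eexists.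
(* Reduce x modulo Z + Z u to coordinates of absolute value at most 1/2:
   there the form is at most 3/2, less than its minimum 2. *)
have near (q : rat) : exists i : int, `|q - i%:~R| <= 2^-1.
  exists (Num.floor (q + 2^-1)); have := floor_itv (q + 2^-1).
  rewrite intrD rmorph1 => /andP [? ?].
  by rewrite ler_norml; apply/andP; split; lra.
have [i Hi] := near s; have [j Hj] := near t.
exists i, j.
set y : Kel := (x.1 - (i%:~R + j%:~R * u.1), x.2 - j%:~R * u.2).
have Hy : OK d y.
  have := OK_add Hx (OK_opp (OK_add (OK_int d i) (OK_mul (OK_int d j) Hou))).
  by congr OK; rewrite /y /Kmul /=; congr (_, _); ring.
have [/eqP y0|/eqP y0] := boolP (y == (0, 0)).
  have := congr1 fst y0; have := congr1 snd y0; rewrite /y /= => /eqP + /eqP.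
  by rewrite !subr_eq0 => /eqP <- /eqP <-; case: (x).
have := HM y Hy y0.
have -> : uform d (1, - r) y = (s - i%:~R) ^+ 2 * 2 + (t - j%:~R) ^+ 2 * uform d (1, -r) u
   + 2 * (s - i%:~R) * (t - j%:~R) * Ktr (Kmul d (1, - r) u).
  rewrite !uformE /y /Ktr /Kmul /=.
  have -> : x.2 = t * u.2 by rewrite Et mulfVK.
  have -> : x.1 = s + t * u.1 by rewrite Es; ring.
  by ring.
rewrite uu; move: Hi Hj tr; move: (s - _) (t - _) (Ktr _) => a b c; clear=> Ha Hb Hc.
have sq (z : rat) : `|z| <= 2^-1 -> z ^+ 2 <= 4^-1.
  by rewrite ler_norml => /andP [? ?]; nra.
have := sq _ Ha; have := sq _ Hb.
have : `|a * b * c| <= 4^-1.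
  rewrite !normrM; have := normr_ge0 a; have := normr_ge0 b; have := normr_ge0 c.
  move: Ha Hb Hc; move: `|a| `|b| `|c| => {}a {}b {}c; clear=> *.
  have ab : a * b <= 4^-1 by nra.
  have ab0 : 0 <= a * b by rewrite mulr_ge0.
  by nra.
by rewrite ler_norml => /andP [? ?] ? ? ?; exfalso; lra.
Qed.


(** * From such an edge back to a single class *)

(** In the basis 1, u the form is 2 i^2 + 2 j^2 + 2 i j Tr(a u), at least 2 (i^2 + j^2 - |i j|) by
    the trace bound, and the bracket is a positive integer unless i = j = 0. *)
Lemma unit_edge_min d r u x : unit_edge d r u -> OK d x -> x <> (0, 0) ->
  2 <= uform d (1, - r) x.
Proof.
case=> r0 rd Hu E tr gen Hx x0; have [i [j Ex]] := gen x Hx.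
have uu : uform d (1, - r) u = 2 by rewrite /uform E /Ktr /= mulr1.
have -> : uform d (1, - r) x = 2 * i%:~R ^+ 2 + j%:~R ^+ 2 * uform d (1, - r) u
   + 2 * (i * j)%:~R * Ktr (Kmul d (1, - r) u).
  by rewrite Ex !uformE /Ktr /Kmul /= intrM; ring.
rewrite uu.
have ij0 : (i != 0) || (j != 0).
  apply: contra_notT x0; rewrite negb_or !negbK => /andP [/eqP i0 /eqP j0].
  by rewrite Ex i0 j0 !mul0r addr0.
have : 1 <= i ^+ 2 + j ^+ 2 - `|i * j|.
  have := sqr_ge0 (i + j); have := sqr_ge0 (i - j); case/orP: ij0 => ? ; nia.
rewrite -(ler_int rat) rmorphB rmorphD /= !rmorphXn /= intr_norm => h.
move: (Ktr _) tr => c Hc.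
have : `|(i * j)%:~R * c| <= `|(i * j)%:~R|.
  by rewrite normrM ler_piMr.
by rewrite ler_norml => /andP [? ?]; lra.
Qed.

Lemma unit_edge_perfect d r u : (1 < d)%N -> squarefree d ->
  unit_edge d r u -> perfect d (1, - r).
Proof.
move=> d1 sf e; have HM := fun x => @unit_edge_min d r u x e.
case: e => r0 rd Hu E _ _; have d0 : 0 < d%:R :> rat by rewrite ltr0n; lia.
have uu : uform d (1, - r) u = 2 by rewrite /uform E /Ktr /= mulr1.
have u1 : uform d (1, - r) Kone = 2 by rewrite uformE /=; ring.
split; first by rewrite totposE // /Knorm /= sqrrN expr1n subr_gt0.
exists 2; split; first by split=> //; exists Kone; split; [exact: OK1 | split].
move=> b _ Hb.
have b1 : b.1 = 1 by have := Hb _ (OK1 d) u1; rewrite uformE /=; lra.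
(* Second coordinate of a u^2 = conj a. It forces [u.1 * u.2 > 0], so the value at [u] determines
   [b.2] once [b.1] is known. *)
have xy : 2 * u.1 * u.2 = r * (1 + u.1 ^+ 2 + d%:R * u.2 ^+ 2).
  by move: E; rewrite /Kmul /= => -[_]; lra.
have xy0 : 0 < u.1 * u.2.
  have : 0 < r * (1 + u.1 ^+ 2 + d%:R * u.2 ^+ 2).
    rewrite mulr_gt0 //; have := sqr_ge0 u.1.
    by have := mulr_ge0 (ltW d0) (sqr_ge0 u.2); lra.
  by rewrite -xy; lra.
have : (b.2 + r) * (d%:R * (u.1 * u.2)) = 0.
  by move: uu (Hb u (proj1 Hu) uu); rewrite !uformE b1 /=; lra.
move/eqP; rewrite mulf_eq0 => /orP [|].
  by rewrite addr_eq0 => /eqP; rewrite -b1; case: (b) => /= ? ? ->.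
by rewrite gt_eqF // mulr_gt0.
Qed.

Lemma trace_min_uniq d a m n : is_trace_min d a m -> is_trace_min d a n -> m = n.
Proof.
move=> [[x [Hx [x0 <-]]] mx] [[y [Hy [y0 <-]]] my].
by apply/le_anti; rewrite mx // my.
Qed.

(** Multiplication by [u] permutes the nonzero elements of O_K and carries minimal vectors of the
    new form to those of [a]; uniqueness is pulled back through the inverse [v]. *)
Lemma perfect_mul_unit_sqr d a u : (1 < d)%N -> squarefree d -> OKunit d u ->
  perfect d a -> perfect d (Kmul d a (Kmul d u u)).
Proof.
move=> d1 sf [Hu [v [Hv uv]]].
have mulK (w w' x : Kel) : Kmul d w w' = Kone -> Kmul d w (Kmul d w' x) = x.
  by move=> E; rewrite KmulA E KmulC Kmul1.
have vu : Kmul d v u = Kone by rewrite KmulC.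
have nz (w x : Kel) : x <> (0, 0) -> forall w', Kmul d w' w = Kone -> Kmul d w x <> (0, 0).
  move=> x0 w' E E0; apply: x0; rewrite -(mulK w' w x E) E0.
  by rewrite /Kmul /= !mulr0 addr0.
have Htp b (w : Kel) : forall w', Kmul d w' w = Kone ->
    totpos d b -> totpos d (Kmul d b (Kmul d w w)).
  move=> w' E; rewrite !totposE // => -[b1 bN].
  have Nw : Knorm d w != 0.
    apply/eqP => N0; have := congr1 (Knorm d) E; rewrite KnormM N0 mulr0 /Knorm /=.
    by move/eqP; rewrite eq_sym expr1n expr0n mulr0 subr0 oner_eq0.
  have N2 : 0 < Knorm d w ^+ 2 by rewrite lt0r sqrf_eq0 Nw sqr_ge0.
  split; last by rewrite !KnormM mulr_gt0.
  have d0 : 0 < d%:R :> rat by rewrite ltr0n; lia.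
  rewrite -(pmulr_rgt0 _ b1) /Kmul /=.
  have w0 : 0 < w.1 ^+ 2 + d%:R * w.2 ^+ 2.
    have q1 := sqr_ge0 w.1; have q2 := mulr_ge0 (ltW d0) (sqr_ge0 w.2).
    rewrite lt0r addr_ge0 // andbT; apply: contra Nw; rewrite paddr_eq0 // /Knorm.
    by move=> /andP [/eqP -> /eqP ->]; rewrite subrr.
  (* Up to the positive factor [b.1], the first coordinate of b w^2 is a sum of nonnegative terms,
     since N(b) > 0. *)
  have -> : b.1 * (b.1 * (w.1 * w.1 + d%:R * w.2 * w.2) + d%:R * b.2 * (w.1 * w.2 + w.2 * w.1))
    = Knorm d b * w.1 ^+ 2 + d%:R * (b.1 * w.2 + b.2 * w.1) ^+ 2.
    by rewrite /Knorm; ring.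
  have p1 : 0 <= Knorm d b * w.1 ^+ 2 by rewrite mulr_ge0 ?sqr_ge0 ?ltW.
  have p2 : 0 <= d%:R * (b.1 * w.2 + b.2 * w.1) ^+ 2 by rewrite mulr_ge0 ?sqr_ge0 ?ltW.
  rewrite lt0r addr_ge0 // andbT paddr_eq0 // !(sqrf_eq0, mulf_eq0) (gt_eqF bN) (gt_eqF d0) /=.
  apply: contraTN w0 => /andP [/eqP ->]; rewrite mulr0 addr0 mulf_eq0 (gt_eqF b1) /= => /eqP ->.
  by rewrite expr0n mulr0 addr0 ltxx.
move=> [ta [m [[[x [Hx [x0 Ex]]] Hm] U]]]; split; first exact: Htp vu ta.
exists m; split.
  split=> [|y Hy y0].
    exists (Kmul d v x); split; first exact: OK_mul.
    by split; [exact: nz uv | rewrite uform_mul mulK].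
  by rewrite uform_mul; apply: Hm; [exact: OK_mul | exact: nz vu].
move=> b tb Hb.
have <- : Kmul d b (Kmul d v v) = a.
  apply: U; first exact: Htp uv tb.
  move=> x' Hx' Ex'; rewrite uform_mul; apply: Hb; first exact: OK_mul.
  by rewrite uform_mul mulK.
rewrite -KmulA -(KmulA _ v v) [X in Kmul d v X]mulK //.
by rewrite vu Kmul1.
Qed.

Lemma equiv_homot_sym d a b : equiv_homot d a b -> equiv_homot d b a.
Proof.
move=> [l [l0 [u [[Hu [v [Hv uv]]] ->]]]].
exists l^-1; split; first by rewrite invr_gt0.
exists v; split; first by split=> //; exists u; rewrite KmulC.
have -> : Kmul d (Kscale l (Kmul d a (Kmul d u u))) (Kmul d v v) =
  Kscale l (Kmul d a (Kmul d (Kmul d u v) (Kmul d u v))).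
  by rewrite /Kscale /Kmul /=; congr (_, _); ring.
rewrite uv !Kmul1 /Kscale /= !mulKf ?lt0r_neq0 //.
exact: surjective_pairing.
Qed.

Lemma equiv_homot_trans d a b c :
  equiv_homot d a b -> equiv_homot d b c -> equiv_homot d a c.
Proof.
move=> [l [l0 [u [Hu ->]]]] [k [k0 [v [Hv ->]]]].
exists (k * l); split; first exact: mulr_gt0.
exists (Kmul d u v); split; first exact: OKunit_mul.
by rewrite /Kscale /Kmul /=; congr (_, _); ring.
Qed.

(** Only finitely many units do at least as well as 1. Passing from [b] to b w^2 then makes 1
    minimal among the units. *)
Lemma exists_min_unit d b : (1 < d)%N -> squarefree d -> totpos d b ->
  exists2 w, OKunit d w & forall w', OKunit d w' -> uform d b w <= uform d b w'.
Proof.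
move=> d1 sf tb.
pose P x := (emb1 d x \in Aint) && ((Knorm d x == 1) || (Knorm d x == -1)).
have PP x : P x <-> OKunit d x.
  rewrite OKunitP //; split=> [/andP [? /orP H]|[? H]].
    by split=> //; case: H => /eqP; auto.
  by apply/andP; split=> //; apply/orP; case: H => ->; rewrite eqxx; auto.
have [s Hs] := OK_sublevel_finite (uform d b Kone) d1 sf tb.
have P1 : P Kone by apply/PP/OKunit1.
have [w Pw Hw] := exists_minimizer (f := uform d b) P1
  (fun x Px le => Hs x (proj1 (iffLR (PP x) Px)) le).
by exists w => [|w' /PP /Hw //]; apply/PP.
Qed.

(** Once 1 is minimal for [b'] among the units, comparison with [u] and its conjugate puts [b'] in
    the cone of a and conj a; perfection then leaves only the two boundary rays. *)
Lemma unit_edge_perfect_equiv d r u b : (1 < d)%N -> squarefree d ->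
  unit_edge d r u -> perfect d b -> equiv_homot d (1, - r) b.
Proof.
move=> d1 sf e Pb; have d0 : 0 < d%:R :> rat by rewrite ltr0n; lia.
have HM := fun x => @unit_edge_min d r u x e.
have HM' x : OK d x -> x <> (0, 0) -> 2 <= uform d (1, r) x.
  move=> Hx x0.
  have -> : uform d (1, r) x = uform d (1, - r) (Kconj x) by rewrite !uformE /=; ring.
  apply: HM; first exact: OK_conj.
  by move=> E; apply: x0; rewrite -[x]KconjK E /Kconj /= oppr0.
have [w Hw minw] := exists_min_unit d1 sf (proj1 Pb).
set b' := Kmul d b (Kmul d w w).
have bb' : equiv_homot d b' b.
  apply: equiv_homot_sym; exists 1; split=> //; exists w; split=> //.
  by rewrite /Kscale !mul1r /b' -surjective_pairing.
have Pb' : perfect d b' by apply: perfect_mul_unit_sqr.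
have min1 w' : OKunit d w' -> 2 * b'.1 <= uform d b' w'.
  move=> Hw'; have -> : 2 * b'.1 = uform d b w by [].
  by rewrite /b' uform_mul; apply: minw; apply: OKunit_mul.
clearbody b'; clear w Hw minw Pb; case: Pb' => [tb [m [Hm U]]].
case: e => r0 rd Hu E tr _.
suff [l l0 [Eb|Eb]] : exists2 l, 0 < l & b' = Kscale l (1, - r) \/ b' = Kscale l (1, r).
- apply: equiv_homot_trans bb'; exists l; split=> //; exists Kone.
  by rewrite !Kmul1; split=> //; apply: OKunit1.
(* The second ray is reached through conj a = a u^2. *)
- by apply: equiv_homot_trans bb'; exists l; split=> //; exists u; rewrite E.
(* [al] and [be] are the coordinates of [b'] along a = (1, -r) and conj a = (1, r). *)
have [al Eal] : exists al, al = (b'.1 - b'.2 / r) / 2 by eexists.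
have [be Ebe] : exists be, be = (b'.1 + b'.2 / r) / 2 by eexists.
have rn : r != 0 by rewrite lt0r_neq0.
have E1 : b'.1 = al + be by rewrite Eal Ebe; field.
have E2 : b'.2 = r * (be - al) by rewrite Eal Ebe; field.
have xy : 2 * u.1 * u.2 = r * (1 + u.1 ^+ 2 + d%:R * u.2 ^+ 2).
  by move: E; rewrite /Kmul /= => -[_]; lra.
have uu : u.1 ^+ 2 + d%:R * u.2 ^+ 2 - 2 * d%:R * r * u.1 * u.2 = 1.
  by move: E; rewrite /Kmul /= => -[+ _]; lra.
have xy0 : 0 < d%:R * r * (u.1 * u.2).
  apply: mulr_gt0; first exact: mulr_gt0.
  have : 0 < r * (1 + u.1 ^+ 2 + d%:R * u.2 ^+ 2).
    rewrite mulr_gt0 //; have := sqr_ge0 u.1.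
    by have := mulr_ge0 (ltW d0) (sqr_ge0 u.2); lra.
  by rewrite -xy; lra.
have S : u.1 ^+ 2 + d%:R * u.2 ^+ 2 = 1 + 2 * (d%:R * r * (u.1 * u.2)) by lra.
(* From 1 to [u] the value of a stays 2 while that of conj a increases, so minimality at 1 forces
   [be >= 0]; the conjugate of [u] does the same for [al]. *)
have be0 : 0 <= be.
  have := min1 u Hu; rewrite uformE E1 E2 S => h.
  have {h} : 0 <= be * (d%:R * r * (u.1 * u.2)) by lra.
  by rewrite pmulr_lge0.
have al0 : 0 <= al.
  have := min1 _ (OKunit_conj d1 sf Hu); rewrite uformE E1 E2 /= sqrrN S => h.
  have {h} : 0 <= al * (d%:R * r * (u.1 * u.2)) by lra.
  by rewrite pmulr_lge0.
have ufE p q v : uform d (p + q, r * (q - p)) v = p * uform d (1, - r) v + q * uform d (1, r) v.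
  by rewrite !uformE /=; ring.
have Eb : b' = (al + be, r * (be - al)) by rewrite -E1 -E2 -surjective_pairing.
have s0 : 0 < al + be by rewrite -E1; case/(totposE _ d1 sf): tb.
have m2 : m = 2 * (al + be).
  apply: trace_min_uniq Hm _; split.
    exists Kone; split; [exact: OK1 | split=> //].
    by rewrite Eb uformE /=; ring.
  move=> x Hx x0; rewrite Eb ufE.
  have := ler_wpM2l al0 (HM x Hx x0); have := ler_wpM2l be0 (HM' x Hx x0); lra.
(* If both coefficients are positive, the minimal vectors of b' are minimal for
   both a and its conjugate, and moving weight from one to the other does not
   change the values there. *)
have [alp|al_le] := ltP 0 al; last first.
  exists be; first by lra.
  have a0 : al = 0 by lra.
  by right; rewrite Eb a0 add0r subr0 /Kscale /= mulr1 mulrC.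
have [bep|be_le] := ltP 0 be; last first.
  exists al; first by lra.
  have a0 : be = 0 by lra.
  by left; rewrite Eb a0 addr0 sub0r /Kscale /= mulr1 !mulrN mulrC.
exfalso.
have : (al / 2 + (be + al / 2), r * (be + al / 2 - al / 2)) = b'.
  apply: U.
    rewrite totposE // /Knorm /=.
    have -> : (al / 2 + (be + al / 2)) ^+ 2 - d%:R * (r * (be + al / 2 - al / 2)) ^+ 2 =
       (al + be) ^+ 2 - be ^+ 2 * (d%:R * r ^+ 2) by field.
    split; first by lra.
    have b2 : 0 < be ^+ 2 by rewrite exprn_gt0.
    have : be ^+ 2 * (d%:R * r ^+ 2) < be ^+ 2 by rewrite gtr_pMr.
    have := mulr_ge0 al0 be0; have := sqr_ge0 al; nra.
  move=> v Hv; rewrite m2 ufE Eb ufE => Ev.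
  have v0 : v <> (0, 0).
    by move=> z; move: Ev; rewrite z !uformE /= => Ev; nra.
  have h1 := HM v Hv v0; have h2 := HM' v Hv v0.
  have i1 : 0 <= al * (uform d (1, - r) v - 2) by rewrite mulr_ge0 // subr_ge0.
  have i2 : 0 <= be * (uform d (1, r) v - 2) by rewrite mulr_ge0 // subr_ge0.
  have z1 : al * (uform d (1, - r) v - 2) = 0 by lra.
  have z2 : be * (uform d (1, r) v - 2) = 0 by lra.
  move/eqP: z1; rewrite mulf_eq0 (gt_eqF alp) subr_eq0 /= => /eqP ->.
  move/eqP: z2; rewrite mulf_eq0 (gt_eqF bep) subr_eq0 /= => /eqP ->.
  by field.
rewrite Eb => -[_ /(mulfI rn)]; lra.
Qed.

Lemma unit_edge_nK_is_one d r u : (1 < d)%N -> squarefree d ->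
  unit_edge d r u -> nK_is_one d.
Proof.
move=> d1 sf e; split; first by exists (1, - r); apply: unit_edge_perfect e.
move=> a b Pa Pb; apply: equiv_homot_trans (unit_edge_perfect_equiv d1 sf e Pb).
exact/equiv_homot_sym/(unit_edge_perfect_equiv d1 sf e Pa).
Qed.


(** * Which [d] admit such an edge *)

(** From a u^2 = conj a and N(u) = 1, the product a u is its own conjugate, hence rational:
    [u.2 = r * u.1], and Tr(a u) = 2 / u.1. *)
Lemma unit_edge_trace_ge d r u : (1 < d)%N -> unit_edge d r u -> Knorm d u = 1 ->
  2 <= `|u.1|.
Proof.
move=> d1 [r0 rd _ E tr _] N1.
have d0 : 0 < d%:R :> rat by rewrite ltr0n; lia.
have dE : d%:R * u.2 ^+ 2 = u.1 ^+ 2 - 1 by move: N1; rewrite /Knorm => ?; lra.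
have u1 : u.1 != 0.
  apply/eqP => u10; have := mulr_ge0 (ltW d0) (sqr_ge0 u.2).
  by rewrite dE u10 expr0n /=; lra.
have u2 : u.2 = r * u.1.
  apply: (mulfI u1); move: E; rewrite /Kmul /= => -[_ e2].
  have : 2 * u.1 * u.2 = r * (1 + u.1 ^+ 2 + d%:R * u.2 ^+ 2) by lra.
  by rewrite dE; lra.
have T : Ktr (Kmul d (1, - r) u) * u.1 = 2.
  by move: N1; rewrite /Knorm /Ktr /Kmul /= u2 => ?; lra.
have := congr1 Num.norm T; rewrite normrM [`|2|]ger0_norm // => <-.
by rewrite ler_piMl.
Qed.

Lemma even_sqr n : ~~ odd n -> exists t, (n ^ 2 = 4 * t)%N.
Proof.
move=> ev; exists (n./2 ^ 2)%N.
by rewrite -{1}[n]even_halfK // -mul2n expnMn.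
Qed.

Lemma odd_sqr n : odd n -> exists t, (n ^ 2 = 4 * t + 1)%N.
Proof.
move=> od; exists (n./2 ^ 2 + n./2)%N.
by rewrite -{1}[n]odd_double_half od -mul2n -!mulnn [nat_of_bool true]/=; move: (n./2) => k; ring.
Qed.

Lemma sqr_abs (z : int) : z ^+ 2 = (`|z| ^ 2)%N%:Z.
Proof. by rewrite -mulnn PoszM !abszE -expr2 real_normK ?num_real. Qed.

(** Squares are 0 or 1 modulo 4, which leaves only even [P] and [Q]: here O_K = Z + Z sqrt d. *)
Lemma norm_form_even (d : nat) (P Q N : int) : (d %% 4 = 2 \/ d %% 4 = 3)%N ->
  P ^+ 2 - d%:Z * Q ^+ 2 = 4 * N -> exists p q : int, P = 2 * p /\ Q = 2 * q.
Proof.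
move=> d4; rewrite !sqr_abs => PQN.
have [oP|/negP eP] := boolP (odd `|P|); have [oQ|/negP eQ] := boolP (odd `|Q|).
- by have [t Et] := odd_sqr oP; have [s Es] := odd_sqr oQ; rewrite Et Es in PQN; lia.
- have [t Et] := odd_sqr oP; have /negP/even_sqr [s Es] := eQ.
  by rewrite Et Es in PQN; lia.
- have /negP/even_sqr [t Et] := eP; have [s Es] := odd_sqr oQ.
  by rewrite Et Es in PQN; lia.
by exists (P %/ 2)%Z, (Q %/ 2)%Z; lia.
Qed.

(** For odd [d], [P] and [Q] have the same parity, so (P + Q sqrt d) / 2 differs from Q (m + sqrt d)
    / 2 by a rational integer. *)
Lemma norm_form_parity (d m : nat) (P Q N : int) : odd d -> odd m ->
  P ^+ 2 - d%:Z * Q ^+ 2 = 4 * N -> exists p : int, P - Q * m%:Z = 2 * p.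
Proof.
move=> od om; rewrite !sqr_abs => PQN.
have [e Ee] : exists e, d = (2 * e + 1)%N by exists d./2; lia.
have [c Ec] : exists c, m = (2 * c + 1)%N by exists m./2; lia.
rewrite Ee in PQN.
have [oP|/negP eP] := boolP (odd `|P|); have [oQ|/negP eQ] := boolP (odd `|Q|).
- exists ((P %/ 2)%Z - (Q %/ 2)%Z - Q * c%:Z); rewrite Ec PoszD PoszM; lia.
- have [t Et] := odd_sqr oP; have /negP/even_sqr [s Es] := eQ.
  by rewrite Et Es in PQN; lia.
- have /negP/even_sqr [t Et] := eP; have [s Es] := odd_sqr oQ.
  by rewrite Et Es in PQN; lia.
have [q Eq] : exists q : int, Q = 2 * q by exists (Q %/ 2)%Z; lia.
by exists ((P %/ 2)%Z - q * m%:Z); rewrite Eq; lia.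
Qed.

(** With u = (P + Q sqrt d) / 2, expressing sqrt d in the basis 1, u forces [Q] to divide 2. The
    cases |Q| = 1, 2 and N(u) = 1, -1 give the four families. *)
Lemma unit_edge_types d r u : (1 < d)%N -> squarefree d -> unit_edge d r u ->
  [\/ exists m : nat, odd m /\ d = (m ^ 2 + 1)%N,
      exists m : nat, ~~ odd m /\ d = (m ^ 2 - 1)%N,
      exists m : nat, odd m /\ d = (m ^ 2 + 4)%N
    | exists m : nat, odd m /\ (3 < m)%N /\ d = (m ^ 2 - 4)%N].
Proof.
move=> d1 sf e.
have /(OKunitP _ d1 sf) [Hu HN] := edge_unit e.
have [P [Q [N [EP EQ PQN EN]]]] := OK_halves d1 sf Hu.
have {}HN : N = 1 \/ N = -1.
  by case: HN; rewrite EN => H; [left|right]; apply: (@intr_inj rat).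
have P4 : N = 1 -> 4 <= `|P|.
  move=> N1; have := unit_edge_trace_ge d1 e; rewrite EN N1 => /(_ erefl).
  rewrite EP normrM normfV [`|2|]ger0_norm // -intr_norm -(ler_int rat) => h; lra.
have sqrtd : OK d (0, 1).
  apply: trace_norm_OK; first by apply/intrP; exists 0; rewrite /= mulr0.
  by apply/intrP; exists (- d%:Z); rewrite /Knorm /= rmorphN /= -pmulrn; ring.
have [i [j [_ Ej]]] := edge_basis e sqrtd.
have jQ : j * Q = 2.
  by apply: (@intr_inj rat); rewrite rmorphM /=; move: Ej; rewrite EQ; lra.
have d4 : (d %% 4 != 0)%N by have := sf 2 isT; rewrite /dvdn.
have Q12 : `|Q|%N = 1%N \/ `|Q|%N = 2%N.
  have dv : (`|Q| %| 2)%N.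
    by apply/dvdnP; exists `|j|%N; rewrite -[RHS]abszM jQ.
  by have := dvdn_leq (ltn0Sn 1) dv; case: `|Q|%N dv => [|[|[|b]]] //; auto.
rewrite !sqr_abs in PQN.
have {}P4 : N = 1 -> (3 < `|P|)%N by move=> /P4; lia.
have [Q1|Q1] := Q12; rewrite Q1 in PQN.
  have odd_P : odd `|P|.
    apply: contraT => /even_sqr [t Et]; case/negP: d4; apply/eqP.
    by move: PQN; rewrite Et; case: HN => ->; lia.
  case: HN => N1; rewrite N1 in PQN.
    by apply: Or44; exists `|P|%N; split=> //; split; [exact: P4 | lia].
  by apply: Or43; exists `|P|%N; split=> //; lia.
have [k Ek] : exists k, `|P|%N = (2 * k)%N.
  have ev : ~~ odd `|P|.
    apply/negP => /odd_sqr [t Et]; move: PQN; rewrite Et; lia.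
  by exists (`|P|./2); rewrite mul2n even_halfK.
have {PQN} dk : (k ^ 2)%N%:Z - d%:Z = N by move: PQN; rewrite Ek expnMn; lia.
case: HN => N1; rewrite N1 in dk.
  apply: Or42; exists k; split; last by lia.
  by apply/negP => /odd_sqr [t Et]; case/negP: d4; apply/eqP; lia.
apply: Or41; exists k; split; last by lia.
apply: contraT => /even_sqr [t Et].
(* An even [k] gives d = 1 modulo 4, so (1 + sqrt d) / 2 is in O_K, yet |Q| = 2 keeps it out of Z +
   Z u. *)
have : OK d (2^-1, 2^-1).
  apply: trace_norm_OK; first by apply/intrP; exists 1.
  apply/intrP; exists (- t%:Z); rewrite /Knorm /=.
  have -> : d%:R = (d%:Z)%:~R :> rat by rewrite -pmulrn.
  have -> : d%:Z = 4 * t%:Z + 1 by lia.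
  by rewrite !(rmorphD, rmorphN, rmorphM) /=; field.
move=> /(edge_basis e) [i' [j' [_]]]; rewrite EQ => Ej'.
have : j' * Q = 1.
  by apply: (@intr_inj rat); rewrite rmorphM /=; move: Ej'; lra.
by move/(congr1 absz); rewrite abszM Q1; lia.
Qed.

(** The relation a u^2 = conj a dictates r: the conjugate of a u is N(u) a u, so a u is a multiple
    of sqrt d if N(u) = -1 and rational if N(u) = 1. *)
Lemma unit_basis_edge d u : (1 < d)%N -> squarefree d ->
  0 < u.1 -> 0 < u.2 -> OK d u ->
  Knorm d u = -1 \/ Knorm d u = 1 /\ 2 <= u.1 ->
  (forall P Q N : int, P ^+ 2 - d%:Z * Q ^+ 2 = 4 * N ->
    exists i j : int, (P%:~R / 2 = i%:~R + j%:~R * u.1) /\ (Q%:~R / 2 = j%:~R * u.2)) ->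
  exists r, unit_edge d r u.
Proof.
move=> d1 sf u1 u2 Hu HN gen.
have d0 : 0 < d%:R :> rat by rewrite ltr0n; lia.
have {}gen x : OK d x -> exists i j : int, x = (i%:~R + j%:~R * u.1, j%:~R * u.2).
  move=> /(OK_halves d1 sf) [P [Q [N [EP EQ PQN _]]]].
  have [i [j [Ei Ej]]] := gen _ _ _ PQN.
  by exists i, j; rewrite -Ei -Ej -EP -EQ -surjective_pairing.
have Uu : OKunit d u by apply/OKunitP => //; split=> //; case: HN => [|[]]; auto.
have u10 := lt0r_neq0 u1; have u20 := lt0r_neq0 u2; have d00 := lt0r_neq0 d0.
have [N1|[N1 u12]] := HN.
  have dE : d%:R * u.2 ^+ 2 = u.1 ^+ 2 + 1.
    by move: N1; rewrite /Knorm => N1; lra.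
  (* Chosen so that Tr(a u) = 0. *)
  exists (u.1 / (d%:R * u.2)); split=> //.
  - by rewrite divr_gt0 ?mulr_gt0.
  - have -> : d%:R * (u.1 / (d%:R * u.2)) ^+ 2 = u.1 ^+ 2 / (d%:R * u.2 ^+ 2).
      by field; rewrite u20.
    by rewrite dE ltr_pdivrMr; have := sqr_ge0 u.1; lra.
  - have e1 : d%:R * (u.1 / (d%:R * u.2)) * u.2 = u.1 by field; rewrite u20.
    have e2 : u.1 / (d%:R * u.2) * (d%:R * u.2 ^+ 2) = u.1 * u.2 by field; rewrite u20.
    move: (u.1 / (d%:R * u.2)) e1 e2 => r e1 e2; rewrite /Kmul /=; congr (_, _).
      transitivity (u.1 ^+ 2 + d%:R * u.2 ^+ 2 - 2 * (d%:R * r * u.2) * u.1); first by ring.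
      by rewrite e1 dE; ring.
    rewrite dE in e2; move: dE e2 => dE e2.
    transitivity (2 * u.1 * u.2 - r * (u.1 ^+ 2 + d%:R * u.2 ^+ 2)); first by ring.
    by rewrite dE; lra.
  - rewrite /Ktr /Kmul /=.
    have -> : 2 * (1 * u.1 + d%:R * - (u.1 / (d%:R * u.2)) * u.2) = 0.
      by field; rewrite u20.
    by rewrite normr0.
have dE : d%:R * u.2 ^+ 2 = u.1 ^+ 2 - 1.
  by move: N1; rewrite /Knorm => N1; lra.
(* Now Tr(a u) = 2 / u.1, and the trace bound is exactly [2 <= u.1]. *)
have [r ru] : exists r, u.2 = r * u.1 by exists (u.2 / u.1); field.
have rd : d%:R * r ^+ 2 * u.1 ^+ 2 = u.1 ^+ 2 - 1 by rewrite -dE ru; ring.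
have r0 : 0 < r by rewrite -(pmulr_lgt0 _ u1) -ru.
exists r; split=> //.
- rewrite -(ltr_pM2r (exprn_gt0 2 u1)) rd; lra.
- rewrite /Kmul /= ru; congr (_, _); first by lra.
  transitivity (r * (u.1 ^+ 2 - d%:R * r ^+ 2 * u.1 ^+ 2)); first by ring.
  by rewrite rd; ring.
- have -> : Ktr (Kmul d (1, - r) u) = 2 / u.1.
    apply: (mulIf u10); rewrite mulfVK // /Ktr /Kmul /= ru; lra.
  have h : 0 <= 2 / u.1 by rewrite divr_ge0 ?ler0n ?ltW.
  by rewrite ger0_norm // ler_pdivrMr // mul1r.
Qed.

Lemma types_unit_edge d : (1 < d)%N -> squarefree d ->
  [\/ exists m : nat, odd m /\ d = (m ^ 2 + 1)%N,
      exists m : nat, ~~ odd m /\ d = (m ^ 2 - 1)%N,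
      exists m : nat, odd m /\ d = (m ^ 2 + 4)%N
    | exists m : nat, odd m /\ (3 < m)%N /\ d = (m ^ 2 - 4)%N] ->
  exists r u, unit_edge d r u.
Proof.
move=> d1 sf.
(* For d = m^2 + 1 and d = m^2 - 1 the unit is m + sqrt d. *)
have intbasis m : (0 < m)%N -> (d %% 4 = 2 \/ d %% 4 = 3)%N ->
    Knorm d (m%:R, 1) = -1 \/ Knorm d (m%:R, 1) = 1 /\ 2 <= m%:R :> rat ->
    exists r u, unit_edge d r u.
  move=> m0 d4 HN; suff [r e] : exists r, unit_edge d r (m%:R, 1) by exists r, (m%:R, 1).
  apply: unit_basis_edge => //=; first by rewrite ltr0n.
    apply: trace_norm_OK; first by apply/intrP; exists (2 * m)%:Z; rewrite /= -pmulrn natrM.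
    by case: HN => [->|[-> _]]; apply/intrP; [exists (-1)|exists 1].
  move=> P Q N PQN.
  have [p [q [Ep Eq]]] := norm_form_even d4 PQN.
  exists (p - q * m%:Z), q; rewrite Ep Eq !(rmorphB, rmorphM) /= -pmulrn.
  by split; field.
(* For d = m^2 + 4 and d = m^2 - 4 the unit is (m + sqrt d) / 2. *)
have halfbasis m : (0 < m)%N -> odd m -> odd d ->
    Knorm d (m%:R / 2, 2^-1) = -1 \/ Knorm d (m%:R / 2, 2^-1) = 1 /\ 2 <= m%:R / 2 :> rat ->
    exists r u, unit_edge d r u.
  move=> m0 om od HN; suff [r e] : exists r, unit_edge d r (m%:R / 2, 2^-1).
    by exists r, (m%:R / 2, 2^-1).
  apply: unit_basis_edge => //=; first by rewrite divr_gt0 ?ltr0n.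
    apply: trace_norm_OK; first by apply/intrP; exists m%:Z; rewrite /= -pmulrn; field.
    by case: HN => [->|[-> _]]; apply/intrP; [exists (-1)|exists 1].
  move=> P Q N PQN.
  have [p Ep] := norm_form_parity od om PQN.
  exists p, Q; split=> //.
  have -> : p%:~R = (P - Q * m%:Z)%:~R / 2 :> rat.
    by rewrite Ep rmorphM /=; field.
  by rewrite !(rmorphB, rmorphM) /= -pmulrn; field.
case=> [[m [om Em]]|[m [em Em]]|[m [om Em]]|[m [om [m3 Em]]]].
- have [t Et] := odd_sqr om.
  apply: (intbasis m); [by case: (m) om | left; lia | left].
  by rewrite /Knorm /= Em natrD natrX; ring.
- have [t Et] := even_sqr em.
  (* [m = 0] would give d = 0 by truncated subtraction. *)
  have m2 : (1 < m)%N by move: em d1; rewrite Em; case: (m) => [|[]].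
  have m21 : (1 <= m ^ 2)%N by rewrite expn_gt0; lia.
  apply: (intbasis m); [exact: ltnW | right; lia | right].
  split; last by rewrite ler_nat.
  by rewrite /Knorm /= Em natrB // natrX; ring.
- apply: (halfbasis m); [by case: (m) om | by [] | by rewrite Em oddD oddX om | left].
  by rewrite /Knorm /= Em natrD natrX; field.
- have m2 : (2 ^ 2 <= m ^ 2)%N by rewrite leq_exp2r //; lia.
  apply: (halfbasis m); [by case: (m) om | by [] | by rewrite Em oddB // oddX om | right].
  split; last first.
    have : (4 : rat) <= m%:R by rewrite ler_nat.
    by lra.
  by rewrite /Knorm /= Em natrB // natrX; field.
Qed.

Theorem theorem1 (d : nat) (hd : (1 < d)%N) (hsf : squarefree d) :
  nK_is_one d <->
  [\/ exists m : nat, odd m /\ d = (m ^ 2 + 1)%N,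
      exists m : nat, ~~ odd m /\ d = (m ^ 2 - 1)%N,
      exists m : nat, odd m /\ d = (m ^ 2 + 4)%N
    | exists m : nat, odd m /\ (3 < m)%N /\ d = (m ^ 2 - 4)%N].
Proof.
split=> [/(nK_is_one_edge hd hsf) [r [u e]]|/(types_unit_edge hd hsf) [r [u e]]].
  exact: unit_edge_types hd hsf e.
exact: unit_edge_nK_is_one hd hsf e.
Qed.
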